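(* Let $M$ be a ring that is not isomorphic to $({\mathbb Z}_2)^r$ for any $r$. Let $G$ be a weakly nice graph and $H$ a loopless graph (both directed, or both undirected), and let $f:E(G)\to E(H)$ be an $M$-tension-continuous mapping. Then $f$ is induced by a homomorphism or by an antihomomorphism from $G$ to $H$. In short, every weakly nice graph is left $M$-homotens.
   Context: Graphs are finite, with multiple edges and loops allowed. A ring means an associative ring with unity. A circuit is a connected subgraph in which every vertex is incident with exactly two edge-ends; for a directed graph and a circuit $C$ with a chosen traversal direction, $C^+$ / $C^-$ are its edges traversed forwards / backwards. An $M$-tension on a directed graph $D$ is $\tau:E(D)\to M$ with $\sum_{e\in C^+}\tau(e)=\sum_{e\in C^-}\tau(e)$ for every circuit $C$. A map $f:E(D)\to E(D')$ of directed graphs is $M$-tension-continuous ($TT_M$) if $\tau\circ f$ is an $M$-tension on $D$ for every $M$-tension $\tau$ on $D'$; for undirected graphs, $f$ is $TT_M$ if it is $TT_M$ for some orientations of both graphs. A homomorphism $h:V(G)\to V(H)$ maps every edge $(u,v)$ to an edge $(h(u),h(v))$; an antihomomorphism maps every edge $(u,v)$ to an edge $(h(v),h(u))$ (for undirected graphs both mean an ordinary homomorphism). $f$ is induced by a homomorphism $h$ if for every edge $(u,v)$ of $G$, $f((u,v))$ is an edge from $h(u)$ to $h(v)$; induced by an antihomomorphism $h$ if $f((u,v))$ is an edge from $h(v)$ to $h(u)$ (undirected: $f(\{u,v\})$ joins $h(u),h(v)$). A graph $G$ is left $M$-homotens if for every loopless graph $H$ every $TT_M$ mapping from $G$ to $H$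 is induced by a homomorphism or an antihomomorphism. An undirected graph is weakly nice if: (1) every edge lies in a triangle; (2) every triangle lies in a copy of $K_4$; (3) for any two copies $K,K'$ of $K_4$ there are vertices $v_1,\dots,v_t$ with $V(K)=\{v_1,\dots,v_4\}$, $V(K')=\{v_{t-3},\dots,v_t\}$, and $v_i,v_j$ adjacent whenever $1\le i<j\le t$ and $j\le i+3$. A directed graph is weakly nice if its underlying undirected graph is.
   Formalization: ''Not isomorphic to (Z_2)^r'' is read for the additive group of M, with r any cardinal and (Z_2)^r a direct sum (for M = F_4 or F_2[x] the claim fails: map K_4 to K_3 by perfect matchings); H is assumed to have at least one vertex. *)

(* Defs.v *)
From HB Require Import structures.
From mathcomp Require Import all_boot all_algebra finmap.

Set Implicit Arguments.
Unset Strict Implicit.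
Unset Printing Implicit Defensive.

Import GRing.Theory.
Local Open Scope ring_scope.

(** * Graphs: finite, with loops and multiple edges *)

Record digraph := Digraph {
  dvert : finType;
  dedge : finType;
  dsrc : dedge -> dvert;
  dtgt : dedge -> dvert }.

(** A loop is an edge whose set of ends is a singleton. *)
Record ugraph := UGraph {
  uvert : finType;
  uedge : finType;
  uends : uedge -> {set uvert};
  card_uends : forall e, (0 < #|uends e| <= 2)%N }.

Definition dends (D : digraph) (e : dedge D) : {set dvert D} :=
  [set dsrc e; dtgt e].

Lemma card_dends (D : digraph) (e : dedge D) : (0 < #|dends e| <= 2)%N.
Proof. by rewrite cards2; case: eqP. Qed.

Definition underlying (D : digraph) : ugraph :=
  UGraph (@card_dends D).

Definition dloopless (D : digraph) : Prop :=
  forall e : dedge D, dsrc e != dtgt e.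

Definition uloopless (G : ugraph) : Prop :=
  forall e : uedge G, #|uends e| = 2%N.

(** * Circuits and tensions *)

Section Circuits.
Variable D : digraph.

(** The number of ends of edges of [F] at [v]; a loop counts twice. *)
Definition edge_ends (F : {set dedge D}) (v : dvert D) : nat :=
  (#|[set e in F | dsrc e == v]| + #|[set e in F | dtgt e == v]|)%N.

Definition dsubgraph (W : {set dvert D}) (F : {set dedge D}) : Prop :=
  forall e, e \in F -> dends e \subset W.

Definition dconnected (W : {set dvert D}) (F : {set dedge D}) : Prop :=
  W != set0 /\
  forall v w, v \in W -> w \in W ->
    connect (fun x y => [exists e in F, dends e == [set x; y]]) v w.

Definition circuit (W : {set dvert D}) (F : {set dedge D}) : Prop :=
  [/\ dsubgraph W F, dconnected W F
    & forall v, v \in W -> edge_ends F v = 2%N].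

(** A traversal direction of a circuit is given by the set [P] of edges
    traversed forwards and the set [N] of edges traversed backwards: every
    vertex is left exactly once and entered exactly once. *)
Definition traversal (W : {set dvert D}) (F P N : {set dedge D}) : Prop :=
  [/\ P :|: N = F, [disjoint P & N],
      forall v, v \in W ->
        (#|[set e in P | dsrc e == v]| + #|[set e in N | dtgt e == v]| = 1)%N
    & forall v, v \in W ->
        (#|[set e in P | dtgt e == v]| + #|[set e in N | dsrc e == v]| = 1)%N].

Definition tension (M : zmodType) (tau : dedge D -> M) : Prop :=
  forall (W : {set dvert D}) (F P N : {set dedge D}),
    circuit W F -> traversal W F P N ->
    \sum_(e in P) tau e = \sum_(e in N) tau e.

End Circuits.

(** * Tension-continuous mappings *)

Definition dTT (M : zmodType) (D D' : digraph) (f : dedge D -> dedge D') : Prop :=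
  forall tau : dedge D' -> M, tension tau -> tension (fun e => tau (f e)).

Definition orientation (G : ugraph) (s t : uedge G -> uvert G) : Prop :=
  forall e, [set s e; t e] = uends e.

Definition uTT (M : zmodType) (G H : ugraph) (f : uedge G -> uedge H) : Prop :=
  exists (s t : uedge G -> uvert G) (s' t' : uedge H -> uvert H),
    [/\ orientation s t, orientation s' t'
      & @dTT M (Digraph s t) (Digraph s' t') f].

(** * Homomorphisms and the edge mappings they induce *)

Section DirectedHom.
Variables G H : digraph.

Definition dhom (h : dvert G -> dvert H) : Prop :=
  forall e : dedge G, exists e' : dedge H,
    dsrc e' = h (dsrc e) /\ dtgt e' = h (dtgt e).

Definition dantihom (h : dvert G -> dvert H) : Prop :=
  forall e : dedge G, exists e' : dedge H,
    dsrc e' = h (dtgt e) /\ dtgt e' = h (dsrc e).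

Definition induced_by_dhom (f : dedge G -> dedge H) : Prop :=
  exists h : dvert G -> dvert H,
    dhom h /\
    forall e, dsrc (f e) = h (dsrc e) /\ dtgt (f e) = h (dtgt e).

Definition induced_by_dantihom (f : dedge G -> dedge H) : Prop :=
  exists h : dvert G -> dvert H,
    dantihom h /\
    forall e, dsrc (f e) = h (dtgt e) /\ dtgt (f e) = h (dsrc e).

End DirectedHom.

Definition uhom (G H : ugraph) (h : uvert G -> uvert H) : Prop :=
  forall e : uedge G, exists e' : uedge H, uends e' = h @: uends e.

(** For undirected graphs antihomomorphisms are the same as homomorphisms. *)
Definition induced_by_uhom (G H : ugraph) (f : uedge G -> uedge H) : Prop :=
  exists h : uvert G -> uvert H,
    uhom h /\ forall e, uends (f e) = h @: uends e.

(** * Weakly nice graphs *)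

Section WeaklyNice.
Variable G : ugraph.

Definition uadj (x y : uvert G) : Prop :=
  exists e : uedge G, uends e = [set x; y].

(** The subgraph [(W, F)] is a copy of the complete graph [K_n]: it has [n]
    vertices and [uends] is a bijection from [F] to the pairs of vertices. *)
Definition Kcopy (n : nat) (W : {set uvert G}) (F : {set uedge G}) : Prop :=
  [/\ #|W| = n, {in F &, injective (@uends G)}
    & [set uends e | e in F] = [set A in powerset W | #|A| == 2%N]].

Definition weakly_nice : Prop :=
  [/\ forall e : uedge G, exists W F, Kcopy 3 W F /\ e \in F,
      forall W F, Kcopy 3 W F ->
        exists W' F', [/\ Kcopy 4 W' F', W \subset W' & F \subset F']
    & forall W F W' F', Kcopy 4 W F -> Kcopy 4 W' F' ->
        exists (t : nat) (v : nat -> uvert G),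
          [/\ (4 <= t)%N,
              W = [set v 1; v 2; v 3; v 4]%N,
              W' = [set v (t - 3); v (t - 2); v (t - 1); v t]%N
            & forall i j : nat, (1 <= i)%N -> (i < j)%N -> (j <= t)%N ->
                (j <= i + 3)%N -> uadj (v i) (v j)]].

End WeaklyNice.

(** * The excluded coefficient groups *)

(** [M] is isomorphic to [(Z_2)^r] for some cardinal [r], the cardinality of
    the index type [I].  Tensions only depend on the additive group of [M], so
    the isomorphism is one of groups, and [(Z_2)^r] is the direct sum of [r]
    copies of [Z_2], that is, the [Z_2]-vector space of dimension [r]; for
    finite [r] this is the direct product. *)
Definition iso_power_Z2 (M : zmodType) : Prop :=
  exists (I : choiceType) (phi : M -> {fsfun I -> 'Z_2 with 0}),
    bijective phi /\ forall x y i, phi (x + y) i = phi x i + phi y i.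

(* Main.v *)
(* A group that satisfies x + x = 0 has a basis over Z_2, so the hypothesis on
   [M] says exactly that 1 + 1 <> 0 in [M].  The coboundary of the indicator of
   each vertex u of H is a tension, hence so is its pull-back along f: along
   every closed walk of G, the images of the edges arrive at u and leave u
   equally often, up to a vanishing multiple of 1.  As 1 + 1 <> 0 and H is
   loopless, a triangle of G can only be mapped as by a homomorphism, as by an
   antihomomorphism, or (if 1 has order 3) to three parallel edges; inside a
   K_4 the last case is impossible and the four triangles agree.  The chains of
   K_4's carry the orientation over to all of G; the image of a vertex is well
   defined because along a chain that starts and ends at the same vertex the
   balance telescopes to the difference of the two candidate images. *)

Require Import Defs.
From mathcomp Require Import all_boot all_algebra.
From mathcomp Require Import finmap zify.
From mathcomp Require boolp classical_sets.

Set Implicit Arguments.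
Unset Strict Implicit.
Unset Printing Implicit Defensive.

Import GRing.Theory.

Lemma uniq_map_inj_in (T T' : eqType) (f : T -> T') (s : seq T) :
  uniq (map f s) -> {in s &, injective f}.
Proof.
elim: s => //= a s IHs /andP[fa_s Us] x y; rewrite !inE.
case/predU1P=> [->|xs] /predU1P[->|ys] // eq_f; last exact: IHs.
- by case/negP: fa_s; rewrite eq_f map_f.
- by case/negP: fa_s; rewrite -eq_f map_f.
Qed.

(** * Closed walks and the sum of a tension along them *)

Section Darts.
Variable D : digraph.
Implicit Types (d : dedge D * bool) (s : seq (dedge D * bool)).

(** A dart is an edge with a direction of traversal, [true] meaning forwards. *)
Definition dart_src d := if d.2 then dsrc d.1 else dtgt d.1.
Definition dart_tgt d := if d.2 then dtgt d.1 else dsrc d.1.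
Definition dart_rev d := (d.1, ~~ d.2).

Definition closed_walk s := cycle (fun d d' => dart_tgt d == dart_src d') s.

Lemma dart_src_rev d : dart_src (dart_rev d) = dart_tgt d.
Proof. by case: d => e []. Qed.

Lemma dart_tgt_rev d : dart_tgt (dart_rev d) = dart_src d.
Proof. by case: d => e []. Qed.

Lemma dart_ends d : dends d.1 = [set dart_src d; dart_tgt d].
Proof. by case: d => e []; rewrite /dends //= setUC. Qed.

(** Each dart ends where the cyclically next one starts, so a closed walk enters every vertex as
    often as it leaves it. *)
Lemma closed_walk_tgt s :
  closed_walk s -> map dart_tgt s = rot 1 (map dart_src s).
Proof.
case: s => // d s; rewrite /closed_walk /= rot1_cons.
elim: s {1 3}d => [|d' s IHs] d0 /=; first by rewrite andbT => /eqP->.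
by case/andP=> /eqP-> /IHs /= ->.
Qed.

Lemma closed_walk_split d p d' q :
  dart_src d = dart_src d' -> closed_walk (d :: p ++ d' :: q) ->
  closed_walk (d :: p) /\ closed_walk (d' :: q).
Proof.
move=> eq_src; rewrite /closed_walk /= rcons_cat cat_path /= !rcons_path.
case/and4P=> -> Rd' -> Rd /=.
by rewrite eq_src Rd' -eq_src.
Qed.

Lemma big_darts (R : Type) (idx : R) (op : Monoid.com_law idx) s
    (F : dedge D * bool -> R) : uniq s ->
  \big[op/idx]_(d <- s) F d =
  op (\big[op/idx]_(e | (e, true) \in s) F (e, true))
     (\big[op/idx]_(e | (e, false) \in s) F (e, false)).
Proof.
move=> Us; rewrite big_uniq //=.
transitivity (\big[op/idx]_(b : bool) \big[op/idx]_(e | (e, b) \in s) F (e, b)).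
  rewrite pair_big_dep /=.
  rewrite (reindex_onto (fun p => (p.2, p.1)) (fun p => (p.2, p.1))) /=; last by case.
  by apply: eq_big => [[b e]|[b e]] //=; rewrite eqxx andbT.
by rewrite big_bool.
Qed.

Lemma card_darts s (a : pred (dedge D * bool)) : uniq s ->
  (#|[set e in [set e | (e, true) \in s] | a (e, true)]| +
   #|[set e in [set e | (e, false) \in s] | a (e, false)]|)%N = count a s.
Proof.
move=> Us; rewrite -sum1_count big_mkcond (big_darts _ _ Us) /= -!big_mkcondr /=.
rewrite !sum1_card; congr addn; apply: eq_card => e; rewrite !inE.
all: by rewrite unfold_in.
Qed.

Lemma walk_connect (R : rel (dvert D)) d s d' :
  path (fun d d' => dart_tgt d == dart_src d') d s ->
  {in d :: s, forall d', R (dart_src d') (dart_tgt d')} ->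
  d' \in d :: s -> connect R (dart_src d) (dart_src d').
Proof.
elim: s d => [|c s IHs] d /=; first by rewrite inE => _ _ /eqP->.
case/andP=> /eqP Rc cs step; rewrite inE => /predU1P[->//|d's].
apply: connect_trans (connect1 (step _ (mem_head _ _))) _; rewrite Rc.
by apply: IHs => // d'' d''s; apply: step; rewrite inE d''s orbT.
Qed.

Lemma closed_walk_connected s : s != [::] -> closed_walk s ->
  dconnected [set x in map dart_src s] [set e in map fst s].
Proof.
case: s => // d s _; rewrite /closed_walk /= rcons_path => /andP[cw _].
split; first by apply/set0Pn; exists (dart_src d); rewrite inE mem_head.
pose F := [set e in map fst (d :: s)].
pose R x y := [exists e in F, dends e == [set x; y]].
have symR : connect_sym R.
  apply: sym_connect_sym => x y.
  by apply: eq_existsb => e; rewrite setUC.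
have step : {in d :: s, forall d', R (dart_src d') (dart_tgt d')}.
  move=> d' d's; apply/existsP; exists d'.1; rewrite dart_ends eqxx andbT /F inE.
  exact: map_f.
have from_d v : v \in [set x in map dart_src (d :: s)] -> connect R (dart_src d) v.
  by rewrite inE => /mapP[d' d's ->]; apply: walk_connect d's.
move=> v w Wv Ww; apply: connect_trans (from_d w Ww).
by rewrite symR; apply: from_d.
Qed.

Variable M : zmodType.
Implicit Type tau : dedge D -> M.
Local Open Scope ring_scope.

Definition dart_val tau d := if d.2 then tau d.1 else - tau d.1.

(** Such a walk is a circuit, traversed with its forward edges [P] and backward edges [N]. Distinct
    vertices alone would not suffice: going along an edge and straight back visits two vertices but
    is no circuit. *)
Lemma tension_simple_walk tau s : tension tau -> closed_walk s ->
  uniq (map dart_src s) -> uniq (map fst s) ->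
  \sum_(d <- s) dart_val tau d = 0.
Proof.
move=> tens cw Usrc Uedge; have Us := map_uniq Usrc.
have [->|s_n0] := eqVneq s [::]; first by rewrite big_nil.
pose P := [set e | (e, true) \in s]; pose N := [set e | (e, false) \in s].
pose W := [set x in map dart_src s]; pose F := [set e in map fst s].
have PNF : P :|: N = F.
  apply/setP=> e; rewrite !inE; apply/orP/mapP => [[es|es]|[[e' []] es ->]].
  - by exists (e, true).
  - by exists (e, false).
  - by left.
  - by right.
have dPN : [disjoint P & N].
  rewrite -setI_eq0; apply/eqP/setP=> e; rewrite !inE; apply/andP=> -[e1 e2].
  by have := uniq_map_inj_in Uedge e1 e2 erefl.
have tgtW d : d \in s -> dart_tgt d \in W.
  by move=> ds; rewrite inE -(mem_rot 1) -closed_walk_tgt // map_f.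
have cout v : v \in W ->
    (#|[set e in P | dsrc e == v]| + #|[set e in N | dtgt e == v]| = 1)%N.
  rewrite inE => Wv; rewrite (card_darts (fun d => dart_src d == v) Us).
  by rewrite -(count_map dart_src (pred1 v)) count_uniq_mem ?Wv.
have cin v : v \in W ->
    (#|[set e in P | dtgt e == v]| + #|[set e in N | dsrc e == v]| = 1)%N.
  rewrite inE => Wv; rewrite (card_darts (fun d => dart_tgt d == v) Us).
  rewrite -(count_map dart_tgt (pred1 v)) closed_walk_tgt // count_uniq_mem ?rot_uniq //.
  by rewrite mem_rot Wv.
have circ : circuit W F.
  split; last 1 first.
  - move=> v Wv; rewrite /edge_ends -PNF.
    have splitF (a : pred (dedge D)) : #|[set e in P :|: N | a e]| =
        (#|[set e in P | a e]| + #|[set e in N | a e]|)%N.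
      rewrite -cardsUI (_ : _ :&: _ = set0) ?cards0 ?addn0.
        by apply: eq_card => e; rewrite !inE andb_orl.
      apply/setP=> e; rewrite !inE.
      have := disjoint_setI0 dPN => /setP/(_ e); rewrite !inE.
      by case: ((e, true) \in s) => //= ->; rewrite andbF.
    by rewrite !splitF [X in (_ + X)%N]addnC addnACA cout // [X in (1 + X)%N]addnC cin.
  - move=> e; rewrite inE => /mapP[d ds ->]; rewrite dart_ends.
    by apply/subsetP=> x; rewrite !inE => /orP[]/eqP->; [exact: map_f|have := tgtW _ ds; rewrite inE].
  - exact: closed_walk_connected.
have := tens W F P N circ (And4 PNF dPN cout cin).
rewrite (big_darts _ _ Us) /= /dart_val /= sumrN.
under eq_bigl do rewrite inE.
under [in RHS]eq_bigl do rewrite inE.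
by move=> ->; rewrite subrr.
Qed.

(** Strong induction on the length: a walk that visits a vertex twice is cut there into two shorter
    closed walks; otherwise it is simple or runs along one edge and back. *)
Lemma tension_closed_walk tau s : tension tau -> closed_walk s ->
  \sum_(d <- s) dart_val tau d = 0.
Proof.
move=> tens; have [n le_sn] := ubnP (size s).
elim: n s le_sn => // n IHn s le_sn cw.
have [Usrc|] := boolP (uniq (map dart_src s)).
  have [/hasP[d ds rds]|/hasPn norev] := boolP (has (fun d => dart_rev d \in s) s).
    have [i p def_s] := rot_to ds.
    have rot_s : perm_eq (d :: p) s by rewrite -def_s perm_rot.
    rewrite -(perm_big _ rot_s) /=.
    have cw' : closed_walk (d :: p) by rewrite -def_s /closed_walk rot_cycle.
    have := Usrc; rewrite -(perm_uniq (perm_map dart_src rot_s)) /=.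
    have : dart_rev d \in d :: p by rewrite (perm_mem rot_s).
    rewrite inE => /predU1P[/(congr1 snd) /=|]; first by case: (d.2).
    case: p {rot_s def_s} cw' => // c p cw' rdp.
    case/andP=> nsrc_d Usrc'.
    have /eqP src_c : dart_tgt d == dart_src c by case/andP: cw'.
    (* [c] starts where [dart_rev d] starts, and sources are distinct. A further dart [k] would
       start at the source of [d] again. *)
    have def_c : c = dart_rev d.
      apply/esym/eqP; move: rdp; rewrite inE => /orP[//|rdp].
      have := map_f dart_src rdp; rewrite dart_src_rev src_c.
      by case/andP: Usrc' => /negP.
    case: p cw' rdp nsrc_d {Usrc'} => [|k p] cw' rdp nsrc_d.
      rewrite !big_cons big_nil addr0 def_c /dart_val /=.
      by case: (d.2); rewrite ?subrr ?addNr.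
    have /eqP src_k : dart_tgt c == dart_src k by case/and3P: cw'.
    case/negP: nsrc_d; rewrite -dart_tgt_rev -def_c src_k.
    by rewrite /= !inE eqxx orbT.
  apply: tension_simple_walk => //.
  (* Two different darts on the same edge are reverses of each other, which [norev] excludes. *)
  rewrite map_inj_in_uniq ?(map_uniq Usrc) // => -[e b] [e' b'] ds d's /= ee'.
  have := norev _ ds; rewrite /dart_rev /=; case: (eqVneq b b') => [-> _|]; first by rewrite ee'.
  by move=> bb'; rewrite (_ : ~~ b = b') ?ee' ?d's //; case: (b) (b') bb' => -[].
case: s le_sn cw => // d0 s; set s0 := d0 :: s => le_sn cw.
case/(uniqPn (dart_src d0)) => i [j [lt_ij]]; rewrite size_map => lt_js.
have lt_is := ltn_trans lt_ij lt_js; rewrite !(nth_map d0) //.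
set d := nth d0 s0 i; set d' := nth d0 s0 j => eq_src.
have def_rot : rot i s0 = d :: drop i.+1 s0 ++ take i s0.
  by rewrite /rot (drop_nth d0).
have : d' \in drop i.+1 s0.
  apply/(nthP d0); exists (j - i.+1)%N; last by rewrite nth_drop subnKC.
  by rewrite size_drop ltn_sub2r // (leq_ltn_trans lt_ij).
case/splitPr def_p: {1}_ / => [p q]; rewrite def_p in def_rot.
have perm_s : perm_eq (d :: p ++ d' :: (q ++ take i s0)) s0.
  by rewrite [d :: _](_ : _ = rot i s0) ?perm_rot // def_rot -catA.
have := cw; rewrite /closed_walk -(rot_cycle i) def_rot -catA => cw'.
have [cw1 cw2] := closed_walk_split eq_src cw'.
have := perm_size perm_s; rewrite /= size_cat /= => eq_sz.
rewrite -(perm_big _ perm_s) /= -cat_cons big_cat /=.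
rewrite !IHn ?addr0 //.
- by move: eq_sz le_sn => /= <-; lia.
- by move: eq_sz le_sn => /= <-; lia.
Qed.

End Darts.

(** * Matching heads and tails counted in multiples of the unit *)

Section Cancellation.
Variables (M : pzRingType) (two_neq0 : (1 + 1 != 0 :> M)%R).
Local Open Scope ring_scope.

(* The multiplicative unit may have order 3, so equal multiples of it can come
   from numbers that differ by 3. *)
Lemma natr_eq_near m n : m%:R = n%:R :> M ->
  [\/ m = n, (m + 3 <= n)%N | (n + 3 <= m)%N].
Proof.
have one_neq0 : (1 != 0 :> M).
  by apply: contraNneq two_neq0 => ->; rewrite addr0.
wlog le_mn : m n / (m <= n)%N => [wl eq_mn|].
  have [/wl|/ltnW/wl/(_ (esym eq_mn))] := leqP m n; first exact.
  by case=> H; [constructor 1|constructor 3|constructor 2].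
rewrite -(subnKC le_mn) natrD; set k := (n - m)%N.
rewrite -[LHS]addr0 => /addrI.
case: k => [|[|[|k]]] eq_k; first by constructor 1; lia.
- by case/eqP: one_neq0; rewrite [RHS]eq_k.
- by case/eqP: two_neq0; rewrite [RHS]eq_k.
- by constructor 2; lia.
Qed.

Variable T : eqType.
Implicit Types a b u : T.

(** If [a2] differed from [b1], the balance at [b1] would equate 1 or 2 with 0. *)
Lemma digon_balance a1 b1 a2 b2 : a1 != b1 -> a2 != b2 ->
  (forall u, ((b1 == u) + (b2 == u))%N%:R = ((a1 == u) + (a2 == u))%N%:R :> M) ->
  b1 = a2.
Proof.
move=> ab1 ab2 /(_ b1)/natr_eq_near; rewrite eqxx (negPf ab1).
by case: (eqVneq a2 b1) ab2 => [->//|_ _]; case: (b2 == b1) => -[].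
Qed.

(** If all heads coincide, the balance at [a1] makes all tails coincide. Exactly two equal heads
    would give 2 against at most 1. If the heads are distinct, each equals exactly one tail, never
    its own, which leaves the two cyclic matchings. *)
Lemma triangle_balance a1 b1 a2 b2 a3 b3 :
  a1 != b1 -> a2 != b2 -> a3 != b3 ->
  (forall u, ((b1 == u) + (b2 == u) + (b3 == u))%N%:R =
             ((a1 == u) + (a2 == u) + (a3 == u))%N%:R :> M) ->
  [\/ [/\ b1 = a2, b2 = a3 & b3 = a1], [/\ b1 = a3, b3 = a2 & b2 = a1]
    | [/\ a1 = a2, a2 = a3, b1 = b2 & b2 = b3]].
Proof.
move=> ab1 ab2 ab3 bal.
have H1 := natr_eq_near (bal b1); have H2 := natr_eq_near (bal b2).
have H3 := natr_eq_near (bal b3); have H4 := natr_eq_near (bal a1).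
move: H1 H2 H3 H4 {bal}; rewrite !eqxx.
rewrite (negPf ab1) (negPf ab2) (negPf ab3) ![b1 == a1]eq_sym (negPf ab1).
have [e12|n12] := eqVneq b1 b2.
  subst b2; rewrite ?eqxx ?(negPf ab2).
  have [e13|n13] := eqVneq b1 b3; last by case: (a3 == b1) => -[].
  subst b3; rewrite ?[b1 == a1]eq_sym ?(negPf ab1) => _ _ _.
  case: (eqVneq a2 a1) => [->|_]; last by case: (a3 == a1) => -[].
  case: (eqVneq a3 a1) => [->|_]; last by case.
  by move=> _; constructor 3.
have [e13|n13] := eqVneq b1 b3.
  by subst b3; rewrite (negPf ab3); case: (a2 == b1) => -[].
have [e23|n23] := eqVneq b2 b3.
  by subst b3; move=> _; rewrite (negPf ab3); case: (a1 == b2) => -[].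
move=> H1 H2 H3 _.
have {}H1 : ((a2 == b1) + (a3 == b1) = 1)%N by case: H1; case: eqP; case: eqP.
have {}H2 : ((a1 == b2) + (a3 == b2) = 1)%N by case: H2; case: eqP; case: eqP.
have {}H3 : ((a1 == b3) + (a2 == b3) = 1)%N by case: H3; case: eqP; case: eqP.
case: (eqVneq a2 b1) H1 => [e21 _|_ H1].
  subst a2; rewrite (negPf n13) in H3; case: eqP H3 => // e1 _.
  subst a1; rewrite [b3 == b2]eq_sym (negPf n23) in H2.
  by case: eqP H2 => // e3 _; constructor 1.
case: eqP H1 => // e3 _; subst a3; rewrite (negPf n12) in H2.
case: eqP H2 => // e1 _; subst a1; rewrite (negPf n23) in H3.
by case: eqP H3 => // e2 _; constructor 2.
Qed.
End Cancellation.

Lemma eq_set2 (T : finType) (a b x y : T) : [set a; b] = [set x; y] ->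
  (a = x /\ b = y) \/ (a = y /\ b = x).
Proof.
move=> eq_ab.
have : a \in [set x; y] by rewrite -eq_ab set21.
have : b \in [set x; y] by rewrite -eq_ab set22.
have : x \in [set a; b] by rewrite eq_ab set21.
have : y \in [set a; b] by rewrite eq_ab set22.
rewrite !inE.
by move=> /orP[]/eqP ? /orP[]/eqP ? /orP[]/eqP ? /orP[]/eqP ?; subst; auto.
Qed.

(** * Images of edges, triangles and copies of [K_4] *)

Section Core.
Variables (M : pzRingType) (two_neq0 : (1 + 1 != 0 :> M)%R).
Variables (G H : digraph) (f : dedge G -> dedge H) (w0 : dvert H).
Hypotheses (H_loopless : dloopless H) (f_TT : dTT M f).
Implicit Types (x y z : dvert G) (u : dvert H).

(** A traversal enters and leaves each vertex of the circuit once; a vertex off the circuit meets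
    none of its edges. *)
Lemma indicator_tension u :
  tension (fun e : dedge H => (dtgt e == u)%:R - (dsrc e == u)%:R : M)%R.
Proof.
move=> W F P N [sub _ _] [PNF _ cout cin].
rewrite !sumrB; apply/eqP; rewrite subr_eq addrAC eq_sym subr_eq; apply/eqP.
rewrite -!natr_sum -!natrD; congr (_%:R)%R.
have cardE (S : {set dedge H}) (a : pred (dedge H)) :
    \sum_(e in S) a e = #|[set e in S | a e]|.
  by rewrite -sum1dep_card big_mkcondr.
rewrite !cardE [LHS]addnC.
have [Wu|nWu] := boolP (u \in W); first by rewrite cout // cin.
have zero (S : {set dedge H}) (g : dedge H -> dvert H) :
    S \subset F -> (forall e, g e \in dends e) -> #|[set e in S | g e == u]| = 0.
  move=> SF g_end; apply/eqP; rewrite cards_eq0; apply/eqP/setP=> e; rewrite !inE.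
  apply/andP=> -[eS /eqP geu]; case/negP: nWu; rewrite -geu.
  by apply: (subsetP (sub e _)) => //; apply: (subsetP SF).
by rewrite !zero // -?PNF ?subsetUl ?subsetUr // => e; rewrite !inE eqxx ?orbT.
Qed.

Definition dart_map (d : dedge G * bool) : dedge H * bool := (f d.1, d.2).

(** The images of consecutive darts need not be consecutive; this balance at each vertex is what
    tension continuity provides. *)
Lemma walk_balance s u : closed_walk s ->
  ((\sum_(d <- s) (dart_tgt (dart_map d) == u))%N%:R =
   (\sum_(d <- s) (dart_src (dart_map d) == u))%N%:R :> M)%R.
Proof.
move=> cw; have := tension_closed_walk (f_TT (indicator_tension u)) cw.
move=> eq0; rewrite !natr_sum; apply/eqP; rewrite -subr_eq0 -sumrB; apply/eqP.
rewrite -[RHS]eq0; apply: eq_bigr => -[e []] _; rewrite /dart_val //=.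
by rewrite opprB.
Qed.

Definition adj x y :=
  [exists d : dedge G * bool, (dart_src d == x) && (dart_tgt d == y)].

(* The end at the image of [x] of the image of an edge from [x] to [y]. *)
Definition near_end x y : dvert H :=
  if [pick d : dedge G * bool | (dart_src d == x) && (dart_tgt d == y)] is Some d
  then dart_src (dart_map d) else w0.

Lemma adjC x y : adj x y = adj y x.
Proof.
apply/existsP/existsP=> -[d /andP[dx dy]]; exists (dart_rev d).
  by rewrite dart_src_rev dart_tgt_rev dx dy.
by rewrite dart_src_rev dart_tgt_rev dx dy.
Qed.

Lemma dart_map_neq d : dart_src (dart_map d) != dart_tgt (dart_map d).
Proof. by case: d => e []; [|rewrite eq_sym]; apply: H_loopless. Qed.

(** The reverse of [d] followed by the picked dart is a closed walk of length two, so parallel edges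
    have images with matching ends. *)
Lemma dart_map_src d : dart_src (dart_map d) = near_end (dart_src d) (dart_tgt d).
Proof.
rewrite /near_end; case: pickP => [d' /andP[/eqP src /eqP tgt]|/(_ d)]; last by rewrite !eqxx.
pose s := [:: dart_rev d; d'].
have cw : closed_walk s by rewrite /closed_walk /= dart_tgt_rev dart_src_rev src tgt !eqxx.
rewrite -(dart_tgt_rev (dart_map d)).
apply: (digon_balance two_neq0 (dart_map_neq (dart_rev d)) (dart_map_neq d')) => u.
by have := walk_balance u cw; rewrite /s !big_cons !big_nil !addn0.
Qed.

Lemma dart_map_tgt d : dart_tgt (dart_map d) = near_end (dart_tgt d) (dart_src d).
Proof. by rewrite -dart_src_rev -[X in near_end X]dart_src_rev -(dart_tgt_rev d) -dart_map_src. Qed.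

Lemma near_end_neq x y : adj x y -> near_end x y != near_end y x.
Proof.
by case/existsP=> d /andP[/eqP<- /eqP<-]; rewrite -dart_map_src -dart_map_tgt dart_map_neq.
Qed.

(** A loop of [G] would have a loop of [H] as its image. *)
Lemma adj_neq x y : adj x y -> x != y.
Proof. by move/near_end_neq; apply: contraNneq => ->. Qed.

(* With [b = true] the star of each vertex is mapped to the star of a vertex
   as by a homomorphism, with [b = false] as by an antihomomorphism. *)
Definition end_at b x y := if b then near_end x y else near_end y x.

Definition aligned b x y z :=
  [/\ end_at b x y = end_at b x z, end_at b y x = end_at b y z
    & end_at b z x = end_at b z y].

Lemma triangle_cases x y z : adj x y -> adj y z -> adj x z ->
  [\/ aligned true x y z, aligned false x y z
    | [/\ near_end x y = near_end y z, near_end y z = near_end z x,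
          near_end y x = near_end z y & near_end z y = near_end x z]].
Proof.
move=> xy yz; rewrite adjC => zx.
have [n1 n2 n3] := And3 (near_end_neq xy) (near_end_neq yz) (near_end_neq zx).
case: (triangle_balance two_neq0 n1 n2 n3).
- move=> u; case/existsP: xy => d1 /andP[/eqP d1x /eqP d1y].
  case/existsP: yz => d2 /andP[/eqP d2y /eqP d2z].
  case/existsP: zx => d3 /andP[/eqP d3z /eqP d3x].
  have cw : closed_walk [:: d1; d2; d3].
    by rewrite /closed_walk /= d1x d1y d2y d2z d3z d3x !eqxx.
  have := walk_balance u cw; rewrite !big_cons !big_nil !addn0 !addnA.
  by rewrite !dart_map_src !dart_map_tgt d1x d1y d2y d2z d3z d3x.
- by case=> *; constructor 1; split.
- by case=> *; constructor 2; split.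
- by constructor 3.
Qed.

(** A triangle aligned both ways would have all its image ends equal. *)
Lemma aligned_inj b b' x y z : adj x y ->
  aligned b x y z -> aligned b' x y z -> b = b'.
Proof.
move=> /near_end_neq/eqP xy; rewrite /aligned /end_at.
by case: b; case: b' => // -[? ? ?] [? ? ?]; case: xy; congruence.
Qed.

Lemma aligned_K4 x1 x2 x3 x4 :
  adj x1 x2 -> adj x1 x3 -> adj x1 x4 -> adj x2 x3 -> adj x2 x4 -> adj x3 x4 ->
  exists b, [/\ aligned b x1 x2 x3, aligned b x1 x2 x4, aligned b x1 x3 x4
              & aligned b x2 x3 x4].
Proof.
move=> a12 a13 a14 a23 a24 a34.
have := near_end_neq a12; have := near_end_neq a13; have := near_end_neq a14.
have := near_end_neq a23; have := near_end_neq a24; have := near_end_neq a34.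
move=> /eqP ? /eqP ? /eqP ? /eqP ? /eqP ? /eqP ?.
have := triangle_cases a12 a23 a13; have := triangle_cases a12 a24 a14.
have := triangle_cases a13 a34 a14; have := triangle_cases a23 a34 a24.
rewrite /aligned /end_at.
(* Three outcomes on each of four triangles: unless all four are aligned in the same direction, the
   equations identify the two ends of some image edge. *)
case=> [[? ? ?]|[? ? ?]|[? ? ? ?]]; case=> [[? ? ?]|[? ? ?]|[? ? ? ?]];
case=> [[? ? ?]|[? ? ?]|[? ? ? ?]]; case=> [[? ? ?]|[? ? ?]|[? ? ? ?]];
  first [by exists true; split; split | by exists false; split; split | exfalso; congruence].
Qed.

(** * Alignment along chains of copies of [K_4] *)

Definition chain t (v : nat -> dvert G) :=
  forall i j, 1 <= i -> i < j -> j <= t -> j <= i + 3 -> adj (v i) (v j).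

Definition aligned_chain b t (v : nat -> dvert G) :=
  forall i j k, 1 <= i -> i < j -> j < k -> k <= t -> k <= i + 3 ->
    aligned b (v i) (v j) (v k).

(** Consecutive windows of four vertices share a triangle, where [aligned_inj] makes their
    directions agree. *)
Lemma chain_aligned t v : 4 <= t -> chain t v -> exists b, aligned_chain b t v.
Proof.
move=> t_ge4 ch.
have window w : 1 <= w -> w + 3 <= t -> exists b, forall i j k,
    w <= i -> i < j -> j < k -> k <= w + 3 -> aligned b (v i) (v j) (v k).
  move=> w1 wt.
  have [||||||b [A1 A2 A3 A4]] := @aligned_K4 (v w) (v w.+1) (v w.+2) (v w.+3);
    try by apply: ch; lia.
  exists b => i j k wi ij jk kw.
  have pos : [\/ [/\ i = w, j = w.+1 & k = w.+2], [/\ i = w, j = w.+1 & k = w.+3],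
     [/\ i = w, j = w.+2 & k = w.+3] | [/\ i = w.+1, j = w.+2 & k = w.+3]].
    have [->|iw] := eqVneq i w.
      have [jw|jw] := eqVneq j w.+1; last by constructor 3; split=> //; lia.
      have [kw'|kw'] := eqVneq k w.+2; first by constructor 1.
      by constructor 2; split=> //; lia.
    by constructor 4; split; lia.
  by case: pos => -[-> -> ->].
have [b Hb] := window 1 isT t_ge4; exists b.
have all_windows w : 1 <= w -> w + 3 <= t -> forall i j k,
    w <= i -> i < j -> j < k -> k <= w + 3 -> aligned b (v i) (v j) (v k).
  elim: w => // -[_ //|w IHw] _ wt; have [b' Hb'] := window w.+2 isT wt.
  have A1 : aligned b (v w.+2) (v w.+3) (v w.+4) by apply: IHw; lia.
  have A2 : aligned b' (v w.+2) (v w.+3) (v w.+4) by apply: Hb'; lia.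
  by rewrite (aligned_inj _ A1 A2) //; apply: ch; lia.
move=> i j k i1 ij jk kt ki.
(* The window starting at [i] may run past the end of the chain; then the last window is used. *)
by apply: (all_windows (minn i (t - 3))); lia.
Qed.

Lemma aligned_chain_end b t v k l m : aligned_chain b t v ->
  1 <= k <= t -> 1 <= l <= t -> 1 <= m <= t -> k != l -> k != m ->
  k <= l + 3 -> l <= k + 3 -> k <= m + 3 -> m <= k + 3 ->
  end_at b (v k) (v l) = end_at b (v k) (v m).
Proof.
move=> A; wlog lt_lm : l m / l < m.
  move=> wl *; have [/wl->//|/wl->//|->//] := ltngtP l m.
move=> kt lt mt kl km kl3 lk3 km3 mk3.
have [lt_kl|lt_lk|] := ltngtP k l; last by lia.
  by have [] : aligned b (v k) (v l) (v m) by apply: A; lia.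
have [lt_km|lt_mk|] := ltngtP k m; last by lia.
(* Here [l < k < m] may be too far apart for one window, so the comparison passes through [k.-1] and
   [k.+1]. *)
- have end_l : end_at b (v k) (v l) = end_at b (v k) (v k.-1).
    have [->//|] := eqVneq l k.-1 => ne.
    by have [] : aligned b (v l) (v k.-1) (v k) by apply: A; lia.
  have end_m : end_at b (v k) (v k.+1) = end_at b (v k) (v m).
    have [->//|] := eqVneq m k.+1 => ne.
    by have [] : aligned b (v k) (v k.+1) (v m) by apply: A; lia.
  by rewrite end_l -end_m; have [] : aligned b (v k.-1) (v k) (v k.+1) by apply: A; lia.
- by have [] : aligned b (v l) (v m) (v k) by apply: A; lia.
Qed.

(** The candidate image of [v k] seen from the chain. The choice of neighbour is immaterial by
    [chain_endE]; the last position has no successor. *)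
Definition chain_end b t (v : nat -> dvert G) k :=
  end_at b (v k) (v (if k < t then k.+1 else k.-1)).

Lemma chain_endE b t v k l : aligned_chain b t v -> 2 <= t ->
  1 <= k <= t -> 1 <= l <= t -> k != l -> k <= l + 3 -> l <= k + 3 ->
  end_at b (v k) (v l) = chain_end b t v k.
Proof.
move=> A t2 kt lt kl kl3 lk3; rewrite /chain_end.
by apply: (aligned_chain_end A) => //; case: (ltnP k t); lia.
Qed.

(** The stretch from [i] to [j] is a closed walk; its balance at the candidate image of [v i]
    telescopes. *)
Lemma chain_end_eq b t v i j : 2 <= t -> chain t v -> aligned_chain b t v ->
  1 <= i <= t -> 1 <= j <= t -> v i = v j ->
  chain_end b t v i = chain_end b t v j.
Proof.
move=> t2 ch A; wlog lt_ij : i j / i < j.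
  move=> wl it jt eq_v; have [ij|ij|->//] := ltngtP i j; first exact: wl.
  exact/esym/wl.
move=> it jt eq_v; set h := chain_end b t v.
(* The range condition sits inside the existential so that choice yields a dart for every [k],
   arbitrary outside the range. *)
have dartP k : exists d, (i <= k < j) ->
    dart_src d = v k /\ dart_tgt d = v k.+1.
  have [kij|] := boolP (i <= k < j).
    have : adj (v k) (v k.+1) by apply: ch; lia.
    by case/existsP=> d /andP[/eqP ? /eqP ?]; exists d.
  have : adj (v i) (v i.+1) by apply: ch; lia.
  by case/existsP=> d _; exists d.
have [g gP] := boolp.choice dartP.
have cw : closed_walk [seq g k | k <- index_iota i j].
  have steps n k : i <= k -> k + n < j ->
      path (fun d d' => dart_tgt d == dart_src d') (g k) [seq g l | l <- iota k.+1 n] /\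
      dart_tgt (last (g k) [seq g l | l <- iota k.+1 n]) = v (k + n).+1.
    elim: n k => [|n IHn] k ik kj /=; first by split=> //; have [|_ ->] := gP k; [lia | rewrite addn0].
    have [| |-> ->] := IHn k.+1; try lia.
    rewrite addSnnS; split=> //; rewrite andbT.
    have [|_ ->] := gP k; first by lia.
    by have [|-> _] := gP k.+1; first by lia.
  rewrite /index_iota; case Dn: (j - i) => [|n] //=.
  rewrite /closed_walk /= rcons_path; have [| |-> ->] := steps n i; try lia.
  have [|-> _] := gP i; first by lia.
  by rewrite eq_v; apply/eqP; congr v; lia.
have := walk_balance (h i) cw.
rewrite !big_map !natr_sum => bal.
have {bal} : (\sum_(i <= k < j) ((h k.+1 == h i)%:R - (h k == h i)%:R) = 0 :> M)%R.
  (* The image of the [k]-th step joins [h k] and [h k.+1], in the order given by [b]. *)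
  have ends k : i <= k < j ->
      near_end (v k) (v k.+1) = (if b then h k else h k.+1) /\
      near_end (v k.+1) (v k) = (if b then h k.+1 else h k).
    move=> kij.
    have : end_at b (v k) (v k.+1) = h k by apply: chain_endE => //; lia.
    have : end_at b (v k.+1) (v k) = h k.+1 by apply: chain_endE => //; lia.
    by rewrite /end_at; case: (b).
  rewrite sumrB; apply/eqP; rewrite subr_eq0; apply/eqP.
  have tgtE : (\sum_(i <= k < j) (dart_tgt (dart_map (g k)) == h i)%:R =
      \sum_(i <= k < j) ((if b then h k.+1 else h k) == h i)%:R :> M)%R.
    apply: eq_big_nat => k kij; rewrite dart_map_tgt.
    by have [-> ->] := gP k kij; have [_ ->] := ends k kij.
  have srcE : (\sum_(i <= k < j) (dart_src (dart_map (g k)) == h i)%:R =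
      \sum_(i <= k < j) ((if b then h k else h k.+1) == h i)%:R :> M)%R.
    apply: eq_big_nat => k kij; rewrite dart_map_src.
    by have [-> ->] := gP k kij; have [-> _] := ends k kij.
  by move: bal; rewrite tgtE srcE; case: (b).
(* The sum is the indicator of [h j = h i] minus 1, so different candidates would give [1 = 0]. *)
rewrite telescope_sumr 1?ltnW // eqxx; case: eqP => // _ /eqP.
rewrite sub0r oppr_eq0 => /eqP one0; case/eqP: two_neq0.
by rewrite -[(1 : M)%R]/(true%:R)%R one0 addr0.
Qed.

Lemma mem_window t (v : nat -> dvert G) w x : w + 3 <= t ->
  x \in [set v w; v w.+1; v w.+2; v w.+3] ->
  exists2 i, (w <= i <= w + 3) && (i <= t) & x = v i.
Proof.
move=> wt; rewrite !inE -!orbA => /or4P[]/eqP->.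
- by exists w => //; lia.
- by exists w.+1 => //; lia.
- by exists w.+2 => //; lia.
- by exists w.+3 => //; lia.
Qed.

Definition aligned_on b (W : {set dvert G}) :=
  forall x y z, x \in W -> y \in W -> z \in W ->
    x != y -> y != z -> x != z -> aligned b x y z.

Lemma aligned_chain_on b t v w : aligned_chain b t v -> 1 <= w -> w + 3 <= t ->
  aligned_on b [set v w; v w.+1; v w.+2; v w.+3].
Proof.
move=> A w1 wt x y z /(mem_window wt)[i it ->] /(mem_window wt)[j jt ->].
case/(mem_window wt)=> k kt -> vij vjk vik.
have [ij jk ik] : [/\ i != j, j != k & i != k].
  by split; [move: vij|move: vjk|move: vik]; apply: contraNneq => ->.
by split; rewrite !(chain_endE A) //; lia.
Qed.

Lemma aligned_on_chain b b' t v : 4 <= t -> chain t v -> aligned_chain b t v ->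
  aligned_on b' [set v 1; v 2; v 3; v 4] -> b = b'.
Proof.
move=> t_ge4 ch A on_b'.
have a12 : adj (v 1) (v 2) by apply: ch; lia.
have a13 : adj (v 1) (v 3) by apply: ch; lia.
have a23 : adj (v 2) (v 3) by apply: ch; lia.
apply: (aligned_inj a12 (z := v 3)); first by apply: A; lia.
by apply: on_b'; rewrite ?inE ?eqxx ?orbT ?adj_neq.
Qed.

(** * From chains to the whole weakly nice graph *)

Hypothesis G_nice : weakly_nice (underlying G).

Lemma uadj_adj x y : uadj (G := underlying G) x y -> adj x y.
Proof.
case=> e /= /eq_set2[[ex ey]|[ex ey]]; apply/existsP.
  by exists (e, true); rewrite /dart_src /dart_tgt /= ex ey !eqxx.
by exists (e, false); rewrite /dart_src /dart_tgt /= ex ey !eqxx.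
Qed.

Lemma adj_Kcopy4 x y : adj x y -> exists (W : {set dvert G}) (F : {set dedge G}),
  [/\ Kcopy (G := underlying G) 4 W F, x \in W & y \in W].
Proof.
case/existsP=> d /andP[/eqP dx /eqP dy]; have [edge_K3 K3_K4 _] := G_nice.
have [W [F [KW dF]]] := edge_K3 d.1.
have [W' [F' [KW' sWW' _]]] := K3_K4 W F KW; exists W', F'.
have : dends d.1 \subset W'.
  apply: subset_trans sWW'; case: KW => _ _ /setP/(_ (dends d.1)).
  by rewrite imset_f // !inE => /esym/andP[].
rewrite dart_ends dx dy => /subsetP sub.
by split=> //; apply: sub; rewrite !inE eqxx ?orbT.
Qed.

Lemma Kcopy4_chain (W W' : {set dvert G}) (F F' : {set dedge G}) :
  Kcopy (G := underlying G) 4 W F -> Kcopy (G := underlying G) 4 W' F' ->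
  exists t v w, [/\ chain t v, 1 <= w, w + 3 = t,
    W = [set v 1; v 2; v 3; v 4] & W' = [set v w; v w.+1; v w.+2; v w.+3]].
Proof.
move=> KW KW'; have [_ _ /(_ W F W' F' KW KW')[t [v [t4 EW EW' ch]]]] := G_nice.
exists t, v, (t - 3); split=> //; try lia.
- by move=> i j i1 ij jt ji; apply/uadj_adj/ch.
- by rewrite EW'; congr [set _; v _; v _; v _]; lia.
Qed.

(** The direction of a fixed copy [W0] spreads to every other copy along a chain; if there is no
    copy, any direction will do. *)
Lemma aligned_on_Kcopy4 : exists b, forall (W : {set dvert G}) (F : {set dedge G}),
  Kcopy (G := underlying G) 4 W F -> aligned_on b W.
Proof.
have [[W0 [F0 KW0]]|noK] := boolp.pselect (exists (W : {set dvert G}) F,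
    Kcopy (G := underlying G) 4 W F); last first.
  by exists true => W F KW; case: noK; exists W, F.
(* The chain from [W0] to itself is used to read off the direction on [W0]. *)
have [t0 [v0 [w0' [ch0 w01 wt0 EW0 _]]]] := Kcopy4_chain KW0 KW0.
have [|b A0] := chain_aligned _ ch0; first by lia.
exists b => W F KW.
have [t [v [w [ch w1 wt EW0' EW]]]] := Kcopy4_chain KW0 KW.
have [|b' A] := chain_aligned _ ch; first by lia.
have on0 : aligned_on b W0 by rewrite EW0; apply: (aligned_chain_on A0) => //; lia.
rewrite -(aligned_on_chain (b' := b) _ ch A) -?EW0' //; last by lia.
by rewrite EW; apply: (aligned_chain_on A); lia.
Qed.

(** A chain joins a copy of [K_4] through [x], [y] to one through [x], [y']. The vertex [x] occurs
    in its first and in its last window, and [chain_end_eq] compares these occurrences. *)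
Lemma end_at_const b x y y' :
  (forall (W : {set dvert G}) (F : {set dedge G}),
     Kcopy (G := underlying G) 4 W F -> aligned_on b W) ->
  adj x y -> adj x y' -> end_at b x y = end_at b x y'.
Proof.
move=> on_b xy xy'.
have [W [F [KW Wx Wy]]] := adj_Kcopy4 xy.
have [W' [F' [KW' Wx' Wy']]] := adj_Kcopy4 xy'.
have [t [v [w [ch w1 wt EW EW']]]] := Kcopy4_chain KW KW'.
have [|b' A] := chain_aligned _ ch; first by lia.
have def_b : b' = b.
  by apply: (aligned_on_chain _ ch A); [lia | rewrite -EW; apply: on_b KW].
rewrite {}def_b {b'} in A; have wt' : w + 3 <= t by lia.
have wt1 : 1 + 3 <= t by lia.
move: Wx Wy Wx' Wy'; rewrite EW EW'.
case/(mem_window wt1) => i it xi /(mem_window wt1)[k kt yk].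
case/(mem_window wt') => j jt xj /(mem_window wt')[l lt yl].
have ik : i != k by apply: contraNneq (adj_neq xy) => eik; rewrite xi yk eik.
have jl : j != l by apply: contraNneq (adj_neq xy') => ejl; rewrite xj yl ejl.
rewrite {1}xi {1}xj yk yl !(chain_endE A) //; try lia.
by apply: chain_end_eq => //; try lia; rewrite -xi.
Qed.

Lemma edge_map_induced : exists b (h : dvert G -> dvert H), forall e,
  dsrc (f e) = h (if b then dsrc e else dtgt e) /\
  dtgt (f e) = h (if b then dtgt e else dsrc e).
Proof.
have [b on_b] := aligned_on_Kcopy4; exists b.
(* A vertex without neighbours goes to the arbitrary [w0]. *)
pose h x := if [pick y | adj x y] is Some y then end_at b x y else w0.
have hE x y : adj x y -> end_at b x y = h x.
  move=> xy; rewrite /h; case: pickP => [y' xy'|/(_ y)]; last by rewrite xy.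
  exact: end_at_const xy xy'.
exists h => e.
have st : adj (dsrc e) (dtgt e) by apply/existsP; exists (e, true); rewrite /= !eqxx.
have ts : adj (dtgt e) (dsrc e) by rewrite adjC.
rewrite -[dsrc (f e)]/(dart_src (dart_map (e, true))).
rewrite -[dtgt (f e)]/(dart_tgt (dart_map (e, true))) dart_map_src dart_map_tgt /=.
by have := hE _ _ st; have := hE _ _ ts; rewrite /end_at; case: (b) => -> ->.
Qed.

End Core.

(** * Groups with [x + x = 0] have a basis over [Z_2] *)

Section Basis.
Variables (M : zmodType) (addxx : forall x : M, (x + x = 0)%R).
Local Open Scope ring_scope.

(** Linear independence over [Z_2]: coefficients are 0 or 1, so a combination is a sum over a
    duplicate-free sequence. *)
Definition Z2_free (B : M -> Prop) := forall s : seq M,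
  uniq s -> (forall x, x \in s -> B x) -> \sum_(x <- s) x = 0 -> s = [::].

Lemma maximal_Z2_free : exists2 B, Z2_free B &
  forall y, exists s : seq M,
    [/\ uniq s, forall x, x \in s -> B x & \sum_(x <- s) x = y].
Proof.
have [C F_free F_tot|B [B_free B_max]] := @classical_sets.Zorn_bigcup M Z2_free.
  move=> s Us sF sum0.
  (* Finitely many elements of the union of a chain of sets lie in one member. *)
  have [//|[X [FX sX]]] : s = [::] \/ exists X, C X /\ forall x, x \in s -> X x.
    elim: s {Us sum0} sF => [|a s IHs] sF; [by left|right].
    have [A CA Aa] := sF a (mem_head _ _).
    have [|->|[X [CX sX]]] := IHs.
    - by move=> x xs; apply: sF; rewrite inE xs orbT.
    - by exists A; split=> // x; rewrite inE => /eqP->.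
    - have [AX|XA] := F_tot _ _ CA CX.
        by exists X; split=> // x; rewrite inE => /predU1P[->|]; [apply: AX|apply: sX].
      by exists A; split=> // x; rewrite inE => /predU1P[->|/sX/XA].
  exact: (F_free X FX).
exists B => // y; have [By|nBy] := boolp.pselect (B y).
  by exists [:: y]; split=> [//|x|]; rewrite ?inE ?big_seq1 // => /eqP->.
have : ~ Z2_free (fun x => x = y \/ B x).
  apply: B_max; split; first by move=> x Bx; right.
  by move=> /(_ y (or_introl erefl)).
(* A relation that becomes possible by adding [y] must contain [y]; as [- y = y], its other terms
   sum to [y]. *)
move=> not_free; apply: boolp.contrapT => no_span; apply: not_free => s Us sB sum0.
have [ys|nys] := boolP (y \in s); last first.
  apply: B_free => // x xs; have [xy|//] := sB x xs.
  by rewrite -xy xs in nys.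
case: no_span; exists (rem y s); split; first exact: rem_uniq.
  move=> x; rewrite mem_rem_uniq // !inE => /andP[/eqP nxy xs].
  by have [] := sB x xs.
move: sum0; rewrite (big_rem y ys) /= => /eqP.
by rewrite addrC addr_eq0 => /eqP->; apply/eqP; rewrite eq_sym -addr_eq0 addxx.
Qed.

Lemma Z2_cases (z : 'Z_2) : z = 0 \/ z = 1.
Proof. by case: z => -[|[|//]] ?; [left|right]; apply: val_inj. Qed.

(** The sum [a + b] is reduced modulo 2 before it acts, which [addxx] makes harmless. *)
Lemma mulrn_Z2D (x : M) (a b : 'Z_2) : x *+ (a + b)%R = x *+ a + x *+ b.
Proof.
by case: (Z2_cases a) (Z2_cases b) => -> [] ->; rewrite ?addr0 ?add0r //= addxx.
Qed.

Lemma iso_power_Z2_of_addxx : iso_power_Z2 M.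
Proof.
have [B B_free B_span] := maximal_Z2_free.
pose I : choiceType := {x : M | boolp.asbool (B x)}.
(* The linear combination of basis elements with coefficients [c]; [psiE] rewrites it over any
   larger index set, so that different [c] can be compared. *)
pose psi (c : {fsfun I -> 'Z_2 with 0}) : M := \sum_(i <- finsupp c) val i.
have psiE c U : (finsupp c `<=` U)%fset -> psi c = \sum_(i <- U) val i *+ c i.
  move=> sub; rewrite -(big_fset_incl _ sub) => [|i _ ci]; last by rewrite fsfun_dflt.
  apply: eq_big_seq => i; rewrite mem_finsupp.
  by case: (Z2_cases (c i)) => -> //; rewrite eqxx.
have psiD (c c1 c2 : {fsfun I -> 'Z_2 with 0}) : (forall i, c i = c1 i + c2 i) -> psi c = psi c1 + psi c2.
  move=> cE; pose U := (finsupp c `|` (finsupp c1 `|` finsupp c2))%fset.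
  rewrite (psiE c U) ?(psiE c1 U) ?(psiE c2 U) -?big_split /=.
  - by apply: eq_bigr => i _; rewrite cE mulrn_Z2D.
  - by apply/fsubsetP=> i; rewrite !in_fsetU => ->; rewrite !orbT.
  - by apply/fsubsetP=> i; rewrite !in_fsetU => ->; rewrite !orbT.
  - by apply/fsubsetP=> i; rewrite !in_fsetU => ->.
have sum (c1 c2 : {fsfun I -> 'Z_2 with 0}) : {c : {fsfun I -> 'Z_2 with 0} | forall i, c i = c1 i + c2 i}.
  exists [fsfun i in (finsupp c1 `|` finsupp c2)%fset => c1 i + c2 i] => i.
  rewrite fsfunE in_fsetU !mem_finsupp; case: eqP => [->|//]; case: eqP => [->|//] /=.
  by rewrite addr0.
(* The pointwise sum of [c1] and [c2] is sent to 0, so freeness empties its support; over [Z_2] this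
   means [c1 = c2]. *)
have psi_inj : injective psi.
  move=> c1 c2 eq12; have [c cE] := sum c1 c2.
  have psi0 : psi c = 0 by rewrite (psiD c c1 c2) // eq12 addxx.
  have supp0 : map val (finsupp c) = [::].
    apply: B_free; last by rewrite big_map.
      by rewrite map_inj_uniq //; apply: val_inj.
    by move=> x /mapP[i _ ->]; apply/boolp.asboolP/(valP i).
  apply/fsfunP=> i; have : c i = 0.
    apply/eqP; rewrite -[_ == _]negbK -mem_finsupp.
    by apply/negP=> /(map_f val); rewrite supp0.
  rewrite cE; case: (Z2_cases (c1 i)) (Z2_cases (c2 i)) => -> [] -> //.
have psi_surj y : exists c, psi c = y.
  have [s [Us sB sum_s]] := B_span y.
  pose S : {fset I} := seq_fset tt (pmap insub s).
  exists [fsfun i in S => (1 : 'Z_2)].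
  rewrite (psiE _ S) ?finsupp_sub //.
  under eq_big_seq => i iS do rewrite fsfunE iS mulr1n.
  rewrite (perm_big _ (seq_fset_perm _ _)) undup_id ?pmap_sub_uniq //=.
  rewrite -(big_map val predT id) (pmap_filter (@insubK _ _ I)).
  rewrite (all_filterP _) //.
  by apply/allP=> x /sB Bx; rewrite isSome_insub; apply/boolp.asboolP.
(* The isomorphism is a chosen right inverse of [psi]; injectivity of [psi] makes it two-sided and
   additive. *)
have [phi phiK] := boolp.choice psi_surj.
exists I, phi; split; first by exists psi => [y|c]; [exact: phiK|apply: psi_inj].
move=> x y i; have [c cE] := sum (phi x) (phi y).
rewrite -cE; congr (fun_of_fsfun _ i); apply: psi_inj.
by rewrite (psiD c _ _ cE) !phiK.
Qed.
End Basis.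

Lemma two_neq0 (M : pzRingType) : ~ iso_power_Z2 M -> (1 + 1 != 0 :> M)%R.
Proof.
move=> not_iso; apply/eqP=> two0; apply: not_iso; apply: iso_power_Z2_of_addxx.
by move=> x; rewrite -[x]mulr1 -mulrDr two0 mulr0.
Qed.

(** * Undirected graphs through orientations, and the conclusion *)

(** The end sets agree by function extensionality and the cardinality proofs by proof irrelevance;
    the equality carries weak niceness over to the oriented graph. *)
Lemma underlying_orientation (G : ugraph) (s t : uedge G -> uvert G) :
  orientation s t -> underlying (Digraph s t) = G.
Proof.
case: G s t => V E ends card_ends s t /= st.
have same (ends' : E -> {set V}) (card_ends' : forall e, (0 < #|ends' e| <= 2)%N) :
    ends' = ends -> UGraph card_ends' = UGraph card_ends.
  by move=> eq_ends; subst ends'; congr UGraph; apply: boolp.Prop_irrelevance.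
exact/same/boolp.funext.
Qed.

Theorem theorem20 (M : pzRingType) (hM : ~ iso_power_Z2 M) :
  (forall (G H : digraph) (f : dedge G -> dedge H),
     weakly_nice (underlying G) -> dloopless H -> 0 < #|dvert H| ->
     dTT M f ->
     induced_by_dhom f \/ induced_by_dantihom f) /\
  (forall (G H : ugraph) (f : uedge G -> uedge H),
     weakly_nice G -> uloopless H -> 0 < #|uvert H| ->
     uTT M f ->
     induced_by_uhom f).
Proof.
have M2 := two_neq0 hM; split=> G H f G_nice H_loopless /card_gt0P[w0 _].
  move=> f_TT; have [b [h hP]] := edge_map_induced M2 w0 H_loopless f_TT G_nice.
  case: b hP => hP; [left|right]; exists h; split=> // e; exists (f e); exact: hP.
case=> s [t [s' [t' [st st' f_TT]]]].
have D'_loopless : dloopless (Digraph s' t').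
  by move=> e; have := H_loopless e; rewrite -st' cards2 /=; case: eqP.
have D_nice : weakly_nice (underlying (Digraph s t)).
  by rewrite (underlying_orientation st).
have [b [h hP]] := edge_map_induced (H := Digraph s' t') M2 w0 D'_loopless f_TT D_nice.
(* Both directions [b] give the same unordered pair of ends. *)
have ends e : uends (f e) = h @: uends e.
  rewrite -st' -st imsetU !imset_set1; have [/= -> ->] := hP e.
  by case: (b) => //; rewrite setUC.
by exists h; split=> // e; exists (f e).
Qed.
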